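(* Let $$\Gamma=\left\langle \frac{1}{3}\begin{pmatrix} 9 & 0 \\ 0 & 1\end{pmatrix},\ \frac{1}{8}\begin{pmatrix} 82 & 2 \\ 9 & 1 \end{pmatrix}\right\rangle \leq \mathrm{PSL}_2\left(\mathbb{Z}\left[\tfrac{1}{6}\right]\right)$$ be the subgroup generated by the classes of the two displayed matrices. Let $T_3$ and $T_4$ be the Bruhat--Tits trees of $\mathrm{PGL}_2(\mathbb{Q}_2)$ and $\mathrm{PGL}_2(\mathbb{Q}_3)$, respectively, and let $\Gamma$ act on the product $T_3\times T_4$ diagonally through the inclusions $\mathrm{PSL}_2(\mathbb{Z}[1/6])\leq \mathrm{PGL}_2(\mathbb{Z}[1/6])\leq \mathrm{PGL}_2(\mathbb{Q}_p)$, $p=2,3$. Then the action of $\Gamma$ on $T_3\times T_4$ is not proper.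
   Context: $T_k$ denotes the $k$-regular tree. For a prime $p$, the Bruhat--Tits tree of $\mathrm{PGL}_2(\mathbb{Q}_p)$ is the $(p+1)$-regular tree whose vertices are the homothety classes of $\mathbb{Z}_p$-lattices in $\mathbb{Q}_p^2$, two vertices being adjacent if they have representatives $L'\subset L$ with $L/L'\cong \mathbb{Z}/p\mathbb{Z}$; the group $\mathrm{PGL}_2(\mathbb{Q}_p)$ acts on it through its action on lattices. Thus $T_3$ corresponds to $p=2$ and $T_4$ to $p=3$. In the resulting action of $\mathrm{PGL}_2(\mathbb{Z}[1/6])$ on $T_3\times T_4$, the stabilizer of the vertex given by the pair of classes of the standard lattices $(\mathbb{Z}_2^2,\mathbb{Z}_3^2)$ is $\mathrm{PGL}_2(\mathbb{Z})$. The group $\Gamma$ is regarded as a discrete group, and its action on the locally compact space $T_3\times T_4$ (product of geometric realizations) is proper if for every compact subset $K\subset T_3\times T_4$ the set $\{\gamma\in\Gamma : \gamma K\cap K\neq\emptyset\}$ is finite. *)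

(* Defs.v *)
From HB Require Import structures.
From mathcomp Require Import all_boot all_order all_algebra.
From mathcomp Require Import generic_quotient.
From mathcomp Require Import all_classical all_reals topology normedtype.

Set Implicit Arguments.
Unset Strict Implicit.
Unset Printing Implicit Defensive.

Import Order.TTheory GRing.Theory Num.Theory.
Import numFieldNormedType.Exports.

Local Open Scope classical_set_scope.
Local Open Scope quotient_scope.
Local Open Scope ring_scope.

(* The ring Z_p is the inverse limit of the rings Z/p^n; an element is stored
   as the sequence of its canonical residues x n in [0, p^n). *)
Definition padic_seq (p : nat) : pred (nat -> int) :=
  fun x => `[< forall n, x n = (x n.+1 %% p%:Z ^+ n)%Z >].

Record padic_int (p : nat) (p_prime : prime p) :=
  PadicInt { residue :> nat -> int; _ : padic_seq p residue }.

Section PadicIntegers.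
Variables (p : nat) (p_prime : prime p).

Local Notation padic_int := (padic_int p_prime).

HB.instance Definition _ := [isSub for @residue p p_prime].
HB.instance Definition _ := [Choice of padic_int by <:].

Implicit Types x y z : padic_int.

Lemma residueS x n : x n = (x n.+1 %% p%:Z ^+ n)%Z.
Proof. by case: x => x /= /asboolP. Qed.

Lemma residue_mod x n : (x n %% p%:Z ^+ n)%Z = x n.
Proof. by rewrite [in LHS]residueS modz_mod -residueS. Qed.

Lemma padic_eq x y :
  (forall n, (x n = y n %[mod p%:Z ^+ n])%Z) -> x = y.
Proof.
move=> xy; apply/val_inj/funext => n.
by rewrite /= -residue_mod xy residue_mod.
Qed.

Lemma modz_dvdm (m n d : int) : (n %| d)%Z -> ((m %% d)%Z = m %[mod n])%Z.
Proof.
move=> nd; apply/eqP; rewrite eqz_mod_dvd [in X in _ - X](divz_eq m d).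
by rewrite opprD addrCA subrr addr0 rpredN dvdz_mull.
Qed.

Definition compatible (f : nat -> int) :=
  forall n, (f n.+1 = f n %[mod p%:Z ^+ n])%Z.

Lemma of_compatible_subproof f : compatible f ->
  padic_seq p (fun n => (f n %% p%:Z ^+ n)%Z).
Proof.
move=> cf; apply/asboolP => n.
by rewrite modz_dvdm ?cf// exprS dvdz_mull.
Qed.

Definition of_compatible f (cf : compatible f) : padic_int :=
  PadicInt _ (of_compatible_subproof cf).

Lemma compatible_residue x : compatible x.
Proof. by move=> n; rewrite -residueS residue_mod. Qed.

Lemma compatible_add x y : compatible (fun n => x n + y n).
Proof. by move=> n; rewrite -modzDm !compatible_residue modzDm. Qed.

Lemma compatible_opp x : compatible (fun n => - x n).
Proof. by move=> n; rewrite -modzNm compatible_residue modzNm. Qed.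

Lemma compatible_mul x y : compatible (fun n => x n * y n).
Proof. by move=> n; rewrite -modzMm !compatible_residue modzMm. Qed.

Lemma compatible_const (a : int) : compatible (fun=> a).
Proof. by []. Qed.

Definition padic_add x y := of_compatible (compatible_add x y).
Definition padic_opp x := of_compatible (compatible_opp x).
Definition padic_mul x y := of_compatible (compatible_mul x y).
Definition padic_const a := of_compatible (compatible_const a).

Let addA : associative padic_add.
Proof. by move=> x y z; apply: padic_eq => n /=; rewrite !modz_mod modzDml modzDmr addrA. Qed.
Let addC : commutative padic_add.
Proof. by move=> x y; apply: padic_eq => n /=; rewrite addrC. Qed.
Let add0 : left_id (padic_const 0) padic_add.
Proof. by move=> x; apply: padic_eq => n /=; rewrite modz_mod mod0z add0r. Qed.
Let addN : left_inverse (padic_const 0) padic_opp padic_add.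
Proof. by move=> x; apply: padic_eq => n /=; rewrite !modz_mod modzDml addNr. Qed.

HB.instance Definition _ := GRing.isZmodule.Build padic_int addA addC add0 addN.

Let mulA : associative padic_mul.
Proof. by move=> x y z; apply: padic_eq => n /=; rewrite !modz_mod modzMml modzMmr mulrA. Qed.
Let mulC : commutative padic_mul.
Proof. by move=> x y; apply: padic_eq => n /=; rewrite mulrC. Qed.
Let mul1 : left_id (padic_const 1) padic_mul.
Proof. by move=> x; apply: padic_eq => n /=; rewrite modz_mod modzMml mul1r. Qed.
Let mulD : left_distributive padic_mul padic_add.
Proof.
move=> x y z; apply: padic_eq => n /=.
by rewrite !modz_mod modzMml mulrDl modzDm.
Qed.
Let one_neq0 : padic_const 1 != padic_const 0.
Proof.
apply/eqP => /(congr1 (fun x => residue x 1)) /=.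
by rewrite expr1 mod0z modz_small//= ltz_nat prime_gt1.
Qed.

HB.instance Definition _ :=
  GRing.Zmodule_isComNzRing.Build padic_int mulA mulC mul1 mulD one_neq0.

Let unit : {pred padic_int} := fun x => `[< exists y, y * x = 1 >].
Let inv x := if pselect (exists y, y * x = 1) is left e then projT1 (cid e) else x.

Let mulVx : {in unit, left_inverse 1 inv *%R}.
Proof.
by move=> x /asboolP ux; rewrite /inv; case: pselect => // e; case: cid.
Qed.
Let unitPl x y : y * x = 1 -> unit x.
Proof. by move=> yx; apply/asboolP; exists y. Qed.
Let invr_out : {in [predC unit], inv =1 id}.
Proof. by move=> x /asboolPn nux; rewrite /inv; case: pselect. Qed.

HB.instance Definition _ :=
  GRing.ComNzRing_hasMulInverse.Build padic_int mulVx unitPl invr_out.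

Lemma residueM x y n : ((x * y) n = x n * y n %[mod p%:Z ^+ n])%Z.
Proof. by rewrite /= modz_mod. Qed.

Lemma residue0 n : (0 : padic_int) n = 0.
Proof. by rewrite /= mod0z. Qed.

Lemma residue_nat a n : ((a%:R : padic_int) n = a%:Z %[mod p%:Z ^+ n])%Z.
Proof.
elim: a => [|a IH]; first by rewrite residue0.
by rewrite -addn1 natrD PoszD -modzDml -IH modzDml /= !modz_mod modzDmr.
Qed.

Lemma residue_le x m n : (m <= n)%N -> (x n = x m %[mod p%:Z ^+ m])%Z.
Proof.
move=> /subnKC <-; elim: (n - m)%N => [|k IH]; first by rewrite addn0.
rewrite -IH addnS [x (m + k)%N]residueS modz_dvdm//.
by rewrite exprD dvdz_mulr.
Qed.

Lemma padic_neq0 x : x != 0 -> exists n, ~~ (p%:Z ^+ n %| x n)%Z.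
Proof.
move=> /eqP x0; apply: contrapT => nh; apply: x0.
apply: padic_eq => n; rewrite residue0 mod0z; apply/dvdz_mod0P.
by apply: contrapT => /negP xn; apply: nh; exists n.
Qed.

Let mulf_eq0 : GRing.integral_domain_axiom padic_int.
Proof.
move=> x y xy0; apply/orP; case: (eqVneq x 0) => [|x0]; first by left.
case: (eqVneq y 0) => [|y0]; first by right.
have [[m xm] [n yn]] := (padic_neq0 x0, padic_neq0 y0).
have aux z i j : (i <= j)%N -> ~~ (p%:Z ^+ i %| z i)%Z ->
    (0 < `|z j|)%N && (logn p `|z j| < i)%N.
  move=> ij zi.
  have {}zi : ~~ (p ^ i %| `|z j|)%N.
    apply: contraNN zi => zj; apply/dvdz_mod0P; rewrite -(residue_le z ij).
    by apply/dvdz_mod0P; rewrite dvdzE abszX.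
  have zj0 : (0 < `|z j|)%N.
    by rewrite lt0n; apply: contraNneq zi => ->; rewrite dvdn0.
  by rewrite zj0 ltnNge -pfactor_dvdn.
have /andP[xk0 xk] := aux x _ _ (leq_addr n m) xm.
have /andP[yk0 yk] := aux y _ _ (leq_addl m n) yn.
have : (p%:Z ^+ (m + n) %| x (m + n)%N * y (m + n)%N)%Z.
  by apply/dvdz_mod0P; rewrite -residueM xy0 residue0 mod0z.
rewrite dvdzE abszX abszM pfactor_dvdn ?muln_gt0 ?xk0// lognM//.
by rewrite leqNgt -addSn leq_add// ltnW.
Qed.

HB.instance Definition _ :=
  GRing.ComUnitRing_isIntegral.Build padic_int mulf_eq0.

Lemma padic_char0 n : (n.+1%:R : padic_int) != 0.
Proof.
apply/eqP => /(congr1 (fun x => (residue x n.+1 %% p%:Z ^+ n.+1)%Z)).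
rewrite residue_nat residue0 mod0z modz_small//=.
by rewrite -rmorphXn ltz_nat/= ltn_expl// prime_gt1.
Qed.

End PadicIntegers.

Section PadicNumbers.
Variables (p : nat) (p_prime : prime p).

Definition padic := {fraction (padic_int p_prime)}.
HB.instance Definition _ := GRing.Field.on padic.

Definition of_padic_int : padic_int p_prime -> padic := @tofrac _.
HB.instance Definition _ := GRing.RMorphism.on of_padic_int.

Lemma intr_padic_inj : injective (intr : int -> padic).
Proof.
suff nz n : (n.+1%:R : padic) != 0.
  move=> a b /eqP; rewrite -subr_eq0 -rmorphB/= => ab; apply/eqP.
  rewrite -subr_eq0; apply: contraTT ab.
  by case: (a - b) => [[|n]|n]//= _; rewrite ?NegzE ?rmorphN ?oppr_eq0 nz.
by rewrite -(rmorph_nat of_padic_int) tofrac_eq0 padic_char0.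
Qed.

Let nz_den x : (denq x)%:~R != 0 :> padic.
Proof.
by rewrite -[0](rmorph0 intr) (inj_eq intr_padic_inj) denq_eq0.
Qed.

Definition rat_to_padic : rat -> padic := @ratr padic.

Fact rat_to_padic_is_zmod_morphism : zmod_morphism rat_to_padic.
Proof.
have injZtoQ: @injective rat int intr by apply: intr_inj.
move=> x y; rewrite /rat_to_padic.
apply: (canLR (mulfK (nz_den _))); apply: (mulIf (nz_den x)).
rewrite mulrAC mulrBl divfK ?nz_den // mulrAC -!rmorphM.
apply: (mulIf (nz_den y)); rewrite mulrAC mulrBl divfK ?nz_den //.
rewrite -!(rmorphM, rmorphB); congr _%:~R; apply: injZtoQ.
rewrite !(rmorphM, rmorphB) /= [_ - _]lock /= -lock !numqE.
by rewrite (mulrAC y) -!mulrBl -mulrA mulrAC !mulrA.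
Qed.

Fact rat_to_padic_is_monoid_morphism : monoid_morphism rat_to_padic.
Proof.
have injZtoQ: @injective rat int intr by apply: intr_inj.
rewrite /rat_to_padic; split=> [|x y]; first by rewrite /ratr divr1.
rewrite /ratr mulrC mulrAC; apply: canLR (mulKf (nz_den _)) _; rewrite !mulrA.
do 2!apply: canRL (mulfK (nz_den _)) _; rewrite -!rmorphM; congr _%:~R.
apply: injZtoQ; rewrite !rmorphM [x * y]lock /= !numqE -lock.
by rewrite -!mulrA mulrA mulrCA -!mulrA (mulrCA y).
Qed.

HB.instance Definition _ := GRing.isZmodMorphism.Build rat padic rat_to_padic
  rat_to_padic_is_zmod_morphism.
HB.instance Definition _ := GRing.isMonoidMorphism.Build rat padic rat_to_padic
  rat_to_padic_is_monoid_morphism.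

End PadicNumbers.

Section UnitGroup.
Variable R : unitRingType.

Record unit_group := UnitGroup { unit_val :> R; _ : unit_val \is a GRing.unit }.

HB.instance Definition _ := [isSub for unit_val].
HB.instance Definition _ := [Choice of unit_group by <:].

Implicit Types u v : unit_group.

Lemma unit_valP u : (u : R) \is a GRing.unit. Proof. by case: u. Qed.

Let mul_subproof u v : (u : R) * (v : R) \is a GRing.unit.
Proof. by rewrite unitrMr ?unit_valP. Qed.
Let inv_subproof u : (u : R)^-1 \is a GRing.unit.
Proof. by rewrite unitrV unit_valP. Qed.

Let one := UnitGroup (@unitr1 R).
Let mul u v := UnitGroup (mul_subproof u v).
Let inv u := UnitGroup (inv_subproof u).

Let mulA : associative mul.
Proof. by move=> u v w; apply/val_inj; rewrite /= mulrA. Qed.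
Let mul1 : left_id one mul.
Proof. by move=> u; apply/val_inj; rewrite /= mul1r. Qed.
Let mulr1 : right_id one mul.
Proof. by move=> u; apply/val_inj; rewrite /= mulr1. Qed.
Let mulV : left_inverse one inv mul.
Proof. by move=> u; apply/val_inj; rewrite /= mulVr ?unit_valP. Qed.
Let mulrV : right_inverse one inv mul.
Proof. by move=> u; apply/val_inj; rewrite /= divrr ?unit_valP. Qed.

HB.instance Definition _ := isGroup.Build unit_group mulA mul1 mulr1 mulV mulrV.

Lemma unit_valM u v : unit_val (u * v)%g = unit_val u * unit_val v.
Proof. by []. Qed.
Lemma unit_val1 : unit_val 1%g = 1.
Proof. by []. Qed.
Lemma unit_valV u : unit_val u^-1%g = (unit_val u)^-1.
Proof. by []. Qed.

End UnitGroup.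

Record normal_subgroup (G : groupType) := NormalSubgroup {
  normal_pred :> {pred G};
  normal_closed : group_closed normal_pred;
  normal_conj : forall g x, x \in normal_pred -> (x ^ g)%g \in normal_pred
}.

Section QuotientGroup.
Variables (G : groupType) (N : normal_subgroup G).
Implicit Types x y z : G.
Local Open Scope group_scope.

Definition coset_rel : rel G := fun x y => x^-1 * y \in normal_pred N.

Let N1 : 1 \in normal_pred N. Proof. by case: (normal_closed N). Qed.
Let NV x : x \in normal_pred N -> x^-1 \in normal_pred N.
Proof. by move=> Nx; rewrite -div1g; apply: (normal_closed N).2. Qed.
Let NM x y : x \in normal_pred N -> y \in normal_pred N -> x * y \in normal_pred N.
Proof. by move=> Nx Ny; rewrite -(invgK y); apply: (normal_closed N).2 => //; exact: NV. Qed.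

Let coset_refl : reflexive coset_rel.
Proof. by move=> x; rewrite /coset_rel mulVg. Qed.
Let coset_sym : symmetric coset_rel.
Proof.
by move=> x y; apply/idP/idP => /NV; rewrite /coset_rel invgM invgK.
Qed.
Let coset_trans : transitive coset_rel.
Proof.
by move=> y x z xy yz; rewrite /coset_rel -(mulgK y x^-1) -mulgA NM.
Qed.

Canonical coset_equiv := EquivRel coset_rel coset_refl coset_sym coset_trans.

Definition quotient_group := {eq_quot coset_rel}.
HB.instance Definition _ := EqQuotient.on quotient_group.
HB.instance Definition _ := Choice.on quotient_group.

Implicit Types a b c : quotient_group.

Definition coset_class (x : G) : quotient_group := \pi_quotient_group x.
Definition coset_repr (a : quotient_group) : G := repr a.

Lemma coset_reprK : cancel coset_repr coset_class.
Proof. exact: reprK. Qed.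

Lemma coset_eqP x y :
  reflect (coset_class x = coset_class y) (x^-1 * y \in normal_pred N).
Proof. exact: eqmodP. Qed.

Lemma coset_rel_repr x : x^-1 * coset_repr (coset_class x) \in normal_pred N.
Proof. by apply/coset_eqP; rewrite coset_reprK. Qed.

Let one : quotient_group := coset_class 1.
Let mul a b : quotient_group := coset_class (coset_repr a * coset_repr b).
Let inv a : quotient_group := coset_class (coset_repr a)^-1.

Let pi_mul x y : mul (coset_class x) (coset_class y) = coset_class (x * y).
Proof.
rewrite /mul; move: (coset_rel_repr x) (coset_rel_repr y).
move: (coset_repr (_ x)) (coset_repr (_ y)) => x' y' xx' yy'.
apply: esym; apply/coset_eqP.
have -> : (x * y)^-1 * (x' * y') = (x^-1 * x') ^ y * (y^-1 * y').
  by rewrite conjgE invgM !mulgA mulgK.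
by apply: NM => //; apply: normal_conj.
Qed.

Let pi_inv x : inv (coset_class x) = coset_class x^-1.
Proof.
rewrite /inv; have := coset_rel_repr x; move: (coset_repr _) => x'.
rewrite -[_ \in _]/(coset_rel x x') coset_sym => xx'; apply: esym; apply/coset_eqP.
have -> : x^-1^-1 * x'^-1 = (x'^-1 * x) ^ x^-1.
  by rewrite conjgE !mulgA mulgK.
exact: normal_conj.
Qed.

Let mulA : associative mul.
Proof.
move=> a b c; rewrite -(coset_reprK a) -(coset_reprK b) -(coset_reprK c).
by rewrite !pi_mul mulgA.
Qed.
Let mul1 : left_id one mul.
Proof. by move=> a; rewrite -(coset_reprK a) pi_mul mul1g. Qed.
Let mulr1 : right_id one mul.
Proof. by move=> a; rewrite -(coset_reprK a) pi_mul mulg1. Qed.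
Let mulV : left_inverse one inv mul.
Proof. by move=> a; rewrite -(coset_reprK a) pi_inv pi_mul mulVg. Qed.
Let mulrV : right_inverse one inv mul.
Proof. by move=> a; rewrite -(coset_reprK a) pi_inv pi_mul mulgV. Qed.

HB.instance Definition _ :=
  isGroup.Build quotient_group mulA mul1 mulr1 mulV mulrV.

Lemma coset_classM x y :
  coset_class (x * y) = coset_class x * coset_class y.
Proof. by rewrite -pi_mul. Qed.

Lemma coset_class1 : coset_class 1 = 1.
Proof. by []. Qed.

Lemma coset_classV x : coset_class x^-1 = (coset_class x)^-1.
Proof. by rewrite -pi_inv. Qed.

End QuotientGroup.

Section ProjectiveGroups.
Variable R : comUnitRingType.

Definition GL2 := unit_group 'M[R]_2.
HB.instance Definition _ := Group.on GL2.

Definition scalar_pred : {pred GL2} := fun g => is_scalar_mx (unit_val g).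

Fact scalar_closed : group_closed scalar_pred.
Proof.
split=> [|u v]; first exact: scalar_mx_is_scalar.
move=> /is_scalar_mxP[a ua] /is_scalar_mxP[b vb].
rewrite unfold_in /scalar_pred unit_valM unit_valV ua vb.
have -> : a%:M / b%:M = (a * b^-1)%:M :> 'M[R]_2.
  by rewrite scalar_mxM -invmx_scalar.
exact: scalar_mx_is_scalar.
Qed.

Fact scalar_conj (g x : GL2) : x \in scalar_pred -> (x ^ g)%g \in scalar_pred.
Proof.
move=> /is_scalar_mxP[a xa]; apply/is_scalar_mxP; exists a.
rewrite conjgE !unit_valM unit_valV xa -[_ * unit_val g]scalar_mxC.
by rewrite mulKr ?unit_valP.
Qed.

Definition scalars := NormalSubgroup scalar_closed scalar_conj.

(* For a local ring or a principal ideal domain, GL_2(R) modulo its scalars is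
   the group of R-points of PGL_2. *)
Definition PGL2 := quotient_group scalars.
HB.instance Definition _ := Group.on PGL2.

Definition SL2_pred : {pred GL2} := fun g => \det (unit_val g) == 1.

Record SL2 := MkSL2 { SL2_val : GL2; _ : SL2_pred SL2_val }.
HB.instance Definition _ := [isSub for SL2_val].
HB.instance Definition _ := [Choice of SL2 by <:].

Fact SL2_closed : group_closed SL2_pred.
Proof.
split=> [|u v]; first by rewrite unfold_in /SL2_pred det1.
move=> /eqP du /eqP dv; rewrite unfold_in /SL2_pred unit_valM unit_valV.
by rewrite det_mulmx det_inv du dv divr1.
Qed.

HB.instance Definition _ := SubChoice_isSubGroup.Build GL2 SL2_pred SL2 SL2_closed.

Definition SL2_mx (g : SL2) : 'M[R]_2 := unit_val (SL2_val g).

Definition pm1_pred : {pred SL2} :=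
  fun g => (SL2_mx g == 1) || (SL2_mx g == -1).

Fact pm1_closed : group_closed pm1_pred.
Proof.
split=> [|u v]; first by rewrite unfold_in /pm1_pred eqxx.
rewrite !unfold_in /pm1_pred => hu hv.
have -> : SL2_mx (u * v^-1)%g = SL2_mx u / SL2_mx v by [].
case/orP: hu => /eqP ->; case/orP: hv => /eqP ->;
  by rewrite ?invrN1 ?divr1 ?mulrN1 ?opprK ?mul1r ?eqxx ?orbT.
Qed.

Fact pm1_conj (g x : SL2) : x \in pm1_pred -> (x ^ g)%g \in pm1_pred.
Proof.
rewrite !unfold_in /pm1_pred => hx.
have -> : SL2_mx (x ^ g)%g = (SL2_mx g)^-1 * (SL2_mx x * SL2_mx g) by [].
case/orP: hx => /eqP ->; first by rewrite mul1r mulVr ?unit_valP ?eqxx.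
by rewrite mulN1r mulrN mulVr ?unit_valP ?eqxx ?orbT.
Qed.

Definition pm1 := NormalSubgroup pm1_closed pm1_conj.

Definition PSL2 := quotient_group pm1.
HB.instance Definition _ := Group.on PSL2.

(* Well defined on classes, see PSL2_to_PGL2E. *)
Definition PSL2_to_PGL2 (g : PSL2) : PGL2 := coset_class scalars (SL2_val (coset_repr g)).

Lemma PSL2_to_PGL2E (g : SL2) :
  PSL2_to_PGL2 (coset_class pm1 g) = coset_class scalars (SL2_val g).
Proof.
apply/esym/coset_eqP; have := coset_rel_repr pm1 g.
move: (coset_repr _) => h.
move=> /orP[] /eqP gh.
  change (is_true (is_scalar_mx (SL2_mx (g^-1 * h)%g))).
  by rewrite gh scalar_mx_is_scalar.
change (is_true (is_scalar_mx (SL2_mx (g^-1 * h)%g))).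
by rewrite gh -raddfN/= scalar_mx_is_scalar.
Qed.

End ProjectiveGroups.

Section FunctorialPGL2.
Variables (R S : comUnitRingType) (f : {rmorphism R -> S}).

Fact GL2_map_subproof (g : GL2 R) : map_mx f (unit_val g) \is a GRing.unit.
Proof. by rewrite (rmorph_unit (map_mx f)) ?unit_valP. Qed.

Definition GL2_map (g : GL2 R) : GL2 S := UnitGroup (GL2_map_subproof g).

(* Well defined on classes, see PGL2_mapE. *)
Definition PGL2_map (g : PGL2 R) : PGL2 S :=
  coset_class (scalars S) (GL2_map (coset_repr g)).

Lemma GL2_mapM g h : GL2_map (g * h)%g = (GL2_map g * GL2_map h)%g.
Proof. by apply/val_inj; exact: (rmorphM (map_mx f)). Qed.

Lemma GL2_mapV g : GL2_map g^-1%g = (GL2_map g)^-1%g.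
Proof. by apply/val_inj; exact: (rmorphV (map_mx f) (unit_valP g)). Qed.

Lemma PGL2_mapE (g : GL2 R) :
  PGL2_map (coset_class (scalars R) g) = coset_class (scalars S) (GL2_map g).
Proof.
apply/esym/coset_eqP; have := coset_rel_repr (scalars R) g.
move: (coset_repr _) => h /is_scalar_mxP[a ha].
rewrite -GL2_mapV -GL2_mapM; apply/is_scalar_mxP; exists (f a).
by rewrite -map_scalar_mx -ha.
Qed.

End FunctorialPGL2.


(* A point of the realization of a graph is given by its barycentric
   coordinates: a function on the vertices supported on a vertex or an edge.
   The topology is the coherent (CW) one: a set is open iff its trace on every
   closed edge, parametrized by [0, 1], is relatively open. *)
Section GeometricRealization.
Variables (R : realType) (V : choiceType) (adj : V -> V -> Prop).

Definition edge_point (v w : V) (t : R) : V -> R :=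
  fun u => (1 - t) * (u == v)%:R + t * (u == w)%:R.

Definition realization_pred : pred (V -> R) := fun x =>
  `[< exists v w t, [/\ v = w \/ adj v w, 0 <= t <= 1 & x = edge_point v w t] >].

Record realization := RealizationPoint {
  coord :> V -> R;
  _ : realization_pred coord
}.
HB.instance Definition _ := [isSub for coord].
HB.instance Definition _ := [Choice of realization by <:].

Definition edge_preimage (U : set realization) (v w : V) :
    set (subspace `[0, 1 : R]%classic) :=
  [set t | exists2 x, U x & coord x = edge_point v w t].

Definition realization_open : set_system realization :=
  [set U | forall v w, adj v w -> open (edge_preimage U v w)].

Let openT : realization_open setT.
Proof.
move=> v w vw; rewrite -open_subspaceIT.
rewrite (_ : _ `&` _ = `[0, 1]%classic); first exact: open_subspaceT.
apply/seteqP; split=> [t []//|t t01]; split=> //.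
have xP : realization_pred (edge_point v w t).
  by apply/asboolP; exists v, w, t; split=> //; right.
by exists (RealizationPoint xP).
Qed.

Let openI : setI_closed realization_open.
Proof.
move=> A B oA oB v w vw.
rewrite (_ : edge_preimage _ _ _ = edge_preimage A v w `&` edge_preimage B v w).
  by apply: openI; [exact: oA|exact: oB].
apply/seteqP; split=> [t [x [Ax Bx] xt]|t [[x Ax xt] [y By yt]]].
  by split; exists x.
by exists x => //; split=> //; rewrite (_ : x = y)//; apply/val_inj; rewrite /= xt.
Qed.

Let open_bigU (I : Type) (f : I -> set realization) :
  (forall i, realization_open (f i)) -> realization_open (\bigcup_i f i).
Proof.
move=> of_ v w vw.
rewrite (_ : edge_preimage _ _ _ = \bigcup_i edge_preimage (f i) v w).
  by apply: bigcup_open => i _; exact: of_.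
apply/seteqP; split=> [t [x [i _ fx] xt]|t [i _ [x fx xt]]].
  by exists i => //; exists x.
by exists x => //; exists i.
Qed.

HB.instance Definition _ :=
  isOpenTopological.Build realization openT openI open_bigU.

Record graph_aut := GraphAut {
  aut_fun :> V -> V;
  aut_inv : V -> V;
  aut_funK : cancel aut_fun aut_inv;
  aut_invK : cancel aut_inv aut_fun;
  aut_adj : forall v w, adj v w -> adj (aut_fun v) (aut_fun w)
}.

(* Pushforward of barycentric coordinates: (f . x)(u) = x(f^-1 u). *)
Lemma realization_act_subproof (f : graph_aut) (x : realization) :
  realization_pred (x \o aut_inv f).
Proof.
case: x => x /= /asboolP[v [w [t [vw t01 ->]]]]; apply/asboolP.
exists (f v), (f w), t; split=> //.
  by case: vw => [->|/(aut_adj f)]; [left|right].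
apply/funext => u; rewrite /edge_point /=.
by rewrite -!(can2_eq (aut_invK f) (aut_funK f)).
Qed.

Definition realization_act (f : graph_aut) (x : realization) : realization :=
  RealizationPoint (realization_act_subproof f x).

End GeometricRealization.

(* Used with O = Z_p, K = Q_p and iota the inclusion. The definitions are stated
   for an arbitrary morphism because conversion on {fraction _} is expensive. *)
Section BruhatTitsTree.
Variables (p : nat) (O : comNzRingType) (K : fieldType).
Variable iota : {rmorphism O -> K}.

(* A lattice is the O-span of a basis of K^2, the columns of B. *)
Definition lattice_pred : pred (set 'cV[K]_2) := fun L =>
  `[< exists B : 'M[K]_2, B \in unitmx /\
      L = [set B *m map_mx iota v | v in [set: 'cV[O]_2]] >].

Record lattice := Lattice {
  lattice_set :> set 'cV[K]_2;
  _ : lattice_pred lattice_set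
}.
HB.instance Definition _ := [isSub for lattice_set].
HB.instance Definition _ := [Choice of lattice by <:].

Implicit Types L M : lattice.

Definition homothetic : rel lattice := fun L M =>
  `[< exists c : K, c != 0 /\ lattice_set M = [set c *: v | v in lattice_set L] >].

Let homothetic_refl : reflexive homothetic.
Proof.
move=> L; apply/asboolP; exists 1; split; first exact: oner_neq0.
apply/seteqP; split=> [v Lv|_ [v Lv <-]]; last by rewrite scale1r.
by exists v => //; rewrite scale1r.
Qed.

Let homothetic_sym : symmetric homothetic.
Proof.
suff sub L M : homothetic L M -> homothetic M L by move=> L M; apply/idP/idP; exact: sub.
move=> /asboolP[c [c0 ML]]; apply/asboolP; exists c^-1.
split; first by rewrite invr_eq0.
rewrite ML; apply/seteqP; split=> [v Lv|_ [_ [v Lv <-] <-]].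
  by exists (c *: v); [exists v|rewrite scalerA mulVf// scale1r].
by rewrite scalerA mulVf// scale1r.
Qed.

Let homothetic_trans : transitive homothetic.
Proof.
move=> M L N /asboolP[c [c0 ML]] /asboolP[d [d0 NM]]; apply/asboolP.
exists (d * c); split; first by rewrite mulf_neq0.
rewrite NM ML; apply/seteqP; split=> [_ [_ [v Lv <-] <-]|_ [v Lv <-]].
  by exists v => //; rewrite scalerA.
by exists (c *: v); [exists v|rewrite scalerA].
Qed.

Canonical homothetic_equiv :=
  EquivRel homothetic homothetic_refl homothetic_sym homothetic_trans.

Definition vertex := {eq_quot homothetic}.
HB.instance Definition _ := EqQuotient.on vertex.
HB.instance Definition _ := Choice.on vertex.

Definition homothety_class (L : lattice) : vertex := \pi_vertex L.
Definition vertex_repr (v : vertex) : lattice := repr v.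

Lemma vertex_reprK : cancel vertex_repr homothety_class.
Proof. exact: reprK. Qed.

Lemma homothety_classP L M :
  reflect (homothety_class L = homothety_class M) (homothetic L M).
Proof. exact: eqmodP. Qed.

(* phi induces an isomorphism from L / L' onto Z/pZ; recall that 'Z_p is Z/pZ
   only for p > 1. *)
Definition quotient_Zp (L L' : set 'cV[K]_2) : Prop :=
  L' `<=` L /\
  exists phi : 'cV[K]_2 -> 'Z_p,
    [/\ forall x y, L x -> L y -> phi (x + y) = phi x + phi y,
        forall x y, L x -> L y -> (phi x = phi y <-> L' (x - y)) &
        phi @` L = setT].

Definition tree_adj (v w : vertex) : Prop :=
  exists L L' : lattice, quotient_Zp L L' /\
    ((homothety_class L = v /\ homothety_class L' = w) \/
     (homothety_class L = w /\ homothety_class L' = v)).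

Lemma lattice_act_subproof (g : GL2 K) L :
  lattice_pred [set unit_val g *m v | v in lattice_set L].
Proof.
case: L => L /= /asboolP[B [Bu ->]]; apply/asboolP.
exists (unit_val g *m B); split.
  by rewrite unitmx_mul Bu (unit_valP g).
by rewrite image_comp; apply: eq_imagel => v _; rewrite /= mulmxA.
Qed.

Definition lattice_act (g : GL2 K) L : lattice :=
  Lattice (lattice_act_subproof g L).

(* Well defined on classes, see vertex_actE. *)
Definition vertex_act (g : PGL2 K) (v : vertex) : vertex :=
  homothety_class (lattice_act (coset_repr g) (vertex_repr v)).

Lemma lattice_actM g h L :
  lattice_act (g * h)%g L = lattice_act g (lattice_act h L).
Proof.
apply/val_inj; rewrite /= image_comp.
by apply: eq_imagel => v _; rewrite /= mulmxA.
Qed.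

Lemma lattice_act1 L : lattice_act 1%g L = L.
Proof.
apply/val_inj; rewrite /= -[RHS]image_id.
by apply: eq_imagel => v _; rewrite /= mul1mx.
Qed.

Lemma vertex_actE g L :
  vertex_act (coset_class (scalars K) g) (homothety_class L) =
  homothety_class (lattice_act g L).
Proof.
apply/esym/homothety_classP/asboolP.
have := coset_rel_repr (scalars K) g; move: (coset_repr _) => h /is_scalar_mxP[a].
rewrite unit_valM unit_valV => ha.
have {}ha : unit_val h = a *: unit_val g.
  by have := mulVKr (unit_valP g) (unit_val h); rewrite ha => <-; exact: mul_mx_scalar.
have a0 : a != 0.
  apply/eqP => a0; have := unit_valP h.
  by rewrite ha a0 scale0r unitr0.
have /homothety_classP/asboolP[c [c0 Lc]] :
    homothety_class L = homothety_class (vertex_repr (homothety_class L)).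
  by rewrite vertex_reprK.
exists (a * c); split; first by rewrite mulf_neq0.
rewrite /= Lc !image_comp; apply: eq_imagel => v _ /=.
by rewrite ha -scalemxAr -scalemxAl scalerA mulrC.
Qed.

Lemma vertex_act1 v : vertex_act 1%g v = v.
Proof. by rewrite -(vertex_reprK v) -coset_class1 vertex_actE lattice_act1. Qed.

Lemma vertex_actM g h v : vertex_act (g * h)%g v = vertex_act g (vertex_act h v).
Proof.
rewrite -(coset_reprK g) -(coset_reprK h) -(vertex_reprK v) -coset_classM.
by rewrite !vertex_actE lattice_actM.
Qed.

Lemma lattice_act_quotient g (L L' : lattice) :
  quotient_Zp L L' -> quotient_Zp (lattice_act g L) (lattice_act g L').
Proof.
move=> [L'L [phi [phiD phiL' phiT]]]; split=> [_ [v Lv <-]|].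
  by exists v => //; exact: L'L.
have gK (v : 'cV[K]_2) : invmx (unit_val g) *m (unit_val g *m v) = v.
  by rewrite mulKmx//; exact: unit_valP.
exists (fun v => phi (invmx (unit_val g) *m v)); split.
- by move=> _ _ [x Lx <-] [y Ly <-]; rewrite -mulmxDr !gK; exact: phiD.
- move=> _ _ [x Lx <-] [y Ly <-]; rewrite !gK -mulmxBr phiL'//.
  split=> [xy|[z Lz /(congr1 (mulmx (invmx (unit_val g))))]]; first by exists (x - y).
  by rewrite !gK => <-.
- by rewrite image_comp -phiT; apply: eq_imagel => v _; rewrite /= gK.
Qed.

Lemma vertex_act_adj g v w :
  tree_adj v w -> tree_adj (vertex_act g v) (vertex_act g w).
Proof.
rewrite -(coset_reprK g); move: (coset_repr g) => {}g.
move=> [L [L' [LL' vw]]]; exists (lattice_act g L), (lattice_act g L').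
split; first exact: lattice_act_quotient.
by case: vw => -[<- <-]; rewrite !vertex_actE; [left|right].
Qed.

Lemma vertex_actK g : cancel (vertex_act g) (vertex_act g^-1%g).
Proof. by move=> v; rewrite -vertex_actM mulVg vertex_act1. Qed.

Lemma vertex_actVK g : cancel (vertex_act g^-1%g) (vertex_act g).
Proof. by move=> v; rewrite -vertex_actM mulgV vertex_act1. Qed.

Definition tree_aut (g : PGL2 K) : graph_aut tree_adj :=
  GraphAut (@vertex_actK g) (@vertex_actVK g) (@vertex_act_adj g).

Lemma tree_aut1 (R : realType) (x : realization R tree_adj) :
  realization_act (tree_aut 1%g) x = x.
Proof.
apply/val_inj/funext => v /=.
by rewrite -[in RHS](vertex_act1 v) -{1}(mulg1 1^-1)%g mulVg.
Qed.

Lemma tree_autM (R : realType) g h (x : realization R tree_adj) :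
  realization_act (tree_aut (g * h)%g) x =
  realization_act (tree_aut g) (realization_act (tree_aut h) x).
Proof.
by apply/val_inj/funext => v /=; rewrite invgM vertex_actM.
Qed.

End BruhatTitsTree.

Arguments tree_adj p {O K} iota v w.
Arguments tree_aut p {O K} iota g.

Definition bt_tree (p : nat) (p_prime : prime p) (R : realType) :=
  realization R (tree_adj p (@of_padic_int p p_prime)).
HB.instance Definition _ p p_prime R := Topological.on (@bt_tree p p_prime R).

Definition bt_act (p : nat) (p_prime : prime p) (R : realType)
    (g : PGL2 (padic p_prime)) : bt_tree p_prime R -> bt_tree p_prime R :=
  realization_act (tree_aut p (@of_padic_int p p_prime) g).


Section ZInv6.

(* x lies in Z[1/6] iff some 6^n x is an integer. *)
Definition zinv6_pred : {pred rat} :=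
  fun x => `[< exists n : nat, 6%:R ^+ n * x \is a Num.int >].

Record zinv6 := Zinv6 { rat_of_zinv6 :> rat; _ : zinv6_pred rat_of_zinv6 }.
HB.instance Definition _ := [isSub for rat_of_zinv6].
HB.instance Definition _ := [Choice of zinv6 by <:].

Fact zinv6_closed : subring_closed zinv6_pred.
Proof.
split=> [|x y|x y].
- by apply/asboolP; exists 0%N; rewrite expr0 mul1r rpred1.
- move=> /asboolP[m xm] /asboolP[n yn]; apply/asboolP; exists (m + n)%N.
  rewrite mulrBr rpredB//.
    by rewrite exprD mulrAC mulrC rpredM// rpredX// intr_nat.
  by rewrite exprD -mulrA rpredM// rpredX// intr_nat.
- move=> /asboolP[m xm] /asboolP[n yn]; apply/asboolP; exists (m + n)%N.
  by rewrite exprD mulrACA rpredM.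
Qed.

HB.instance Definition _ :=
  GRing.SubChoice_isSubComNzRing.Build rat zinv6_pred zinv6 zinv6_closed.

Definition zinv6_unit : {pred zinv6} :=
  fun x => (val x != 0) && zinv6_pred (val x)^-1.
Definition zinv6_inv (x : zinv6) : zinv6 :=
  if zinv6_unit x then insubd x (val x)^-1 else x.

Let mulVx : {in zinv6_unit, left_inverse 1 zinv6_inv *%R}.
Proof.
move=> x ux; have /andP[x0 xV] := ux; apply/val_inj.
rewrite rmorphM /= /zinv6_inv ifT// val_insubd ifT//.
by rewrite mulVf.
Qed.
Let unitPl x y : y * x = 1 -> zinv6_unit x.
Proof.
move=> /(congr1 val); rewrite rmorphM rmorph1/= => yx.
have x0 : val x != 0.
  by apply: contra_eq_neq yx => ->; rewrite mulr0 eq_sym oner_neq0.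
rewrite /zinv6_unit x0 /= -[_^-1]mul1r -yx mulfK//.
exact: (valP y).
Qed.
Let invr_out : {in [predC zinv6_unit], zinv6_inv =1 id}.
Proof. by move=> x nux; rewrite /zinv6_inv ifN. Qed.

HB.instance Definition _ :=
  GRing.ComNzRing_hasMulInverse.Build zinv6 mulVx unitPl invr_out.

Definition zinv6_to_padic (p : nat) (p_prime : prime p) (x : zinv6) :
  padic p_prime := rat_to_padic p_prime (val x).
HB.instance Definition _ (p : nat) (p_prime : prime p) :=
  GRing.RMorphism.copy (@zinv6_to_padic p p_prime)
    (rat_to_padic p_prime \o (val : zinv6 -> rat)).

Lemma zinv6_natr_unit (n k : nat) : (0 < n)%N -> (n %| 6 ^ k)%N -> (n%:R : zinv6) \is a GRing.unit.
Proof.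
move=> n0 /dvdnP[m mn]; apply/andP; rewrite rmorph_nat pnatr_eq0 -lt0n; split=> //.
apply/asboolP; exists k; rewrite -natrX mn natrM mulfK ?intr_nat//.
by rewrite pnatr_eq0 -lt0n.
Qed.

End ZInv6.

Definition mx2 (R : Type) (a b c d : R) : 'M[R]_2 :=
  \matrix_(i, j) if i == 0 then (if j == 0 then a else b)
                 else (if j == 0 then c else d).

Lemma det_mx2 (R : comNzRingType) (a b c d : R) :
  \det (mx2 a b c d) = a * d - b * c.
Proof.
rewrite (expand_det_row _ 0) !big_ord_recl big_ord0 addr0 /cofactor !det_mx11.
by rewrite !mxE /= expr0 expr1 mul1r mulN1r mulrN.
Qed.

Section SL2OfMatrix.
Variables (R : comUnitRingType) (A : 'M[R]_2) (detA : \det A = 1).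

Fact SL2_of_mx_unit : A \is a GRing.unit.
Proof. by rewrite -[_ \is a _]/(A \in unitmx) unitmxE detA unitr1. Qed.

Fact SL2_of_mx_det : SL2_pred (UnitGroup SL2_of_mx_unit).
Proof. exact/eqP. Qed.

Definition SL2_of_mx : SL2 R := MkSL2 SL2_of_mx_det.
End SL2OfMatrix.

Definition genA : 'M[zinv6]_2 := 3%:R^-1 *: mx2 9%:R 0 0 1.
Definition genB : 'M[zinv6]_2 := 8%:R^-1 *: mx2 82%:R 2%:R 9%:R 1.

Fact det_genA : \det genA = 1.
Proof.
rewrite detZ det_mx2 mulr1 mulr0 subr0 (_ : 9 = 3 * 3)%N// natrM.
by rewrite expr2 mulrACA mulVr ?mulr1// (@zinv6_natr_unit _ 1).
Qed.

Fact det_genB : \det genB = 1.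
Proof.
rewrite detZ det_mx2 mulr1 -natrM -natrB// (_ : 82 - 2 * 9 = 8 * 8)%N// natrM.
by rewrite expr2 mulrACA mulVr ?mulr1// (@zinv6_natr_unit _ 3).
Qed.

Definition is_subgroup (G : groupType) : set (set G) :=
  [set H | H 1%g /\ forall x y, H x -> H y -> H (x / y)%g].

Definition Gamma : set (PSL2 zinv6) :=
  smallest (@is_subgroup _)
    [set coset_class (pm1 zinv6) (SL2_of_mx det_genA);
         coset_class (pm1 zinv6) (SL2_of_mx det_genB)].

Definition PSL2_to_PGL2_padic (p : nat) (p_prime : prime p)
    (g : PSL2 zinv6) : PGL2 (padic p_prime) :=
  PGL2_map (@zinv6_to_padic p p_prime) (PSL2_to_PGL2 g).

Definition T3 (R : realType) := bt_tree (isT : prime 2) R.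
HB.instance Definition _ R := Topological.on (T3 R).
Definition T4 (R : realType) := bt_tree (isT : prime 3) R.
HB.instance Definition _ R := Topological.on (T4 R).

Definition diagonal_act (R : realType) (g : PSL2 zinv6) (x : T3 R * T4 R) :
    T3 R * T4 R :=
  (bt_act (PSL2_to_PGL2_padic _ g) x.1, bt_act (PSL2_to_PGL2_padic _ g) x.2).

Definition proper_action (G : Type) (H : set G) (X : topologicalType)
    (act : G -> X -> X) : Prop :=
  forall C : set X, compact C ->
    finite_set [set g | H g /\ (act g @` C) `&` C !=set0].

(* Main.v *)
From HB Require Import structures.
Require Import Defs.
From Stdlib Require Import ZArith.
From mathcomp Require Import all_boot all_order all_algebra.
From mathcomp Require Import all_classical all_reals topology.
From mathcomp Require Import ssrZ ring.

(** An action is not proper as soon as infinitely many group elements fix one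
point.  The point chosen here is the pair of standard vertices: a matrix in
SL_2(Z) maps Z_p^2 onto itself for every p, hence fixes that pair
([standard_vertex_fixed]).  It remains to see that Gamma meets the image of
SL_2(Z) in an infinite set, and one element of infinite order is enough.

No such element is visible on the generators, since A translates along an axis of
T_4 and B along an axis of T_3.  The 42-letter word [loop] is what the proof rests
on.  It has the form h^-1 g, where g and h are words of 21 letters that move the
pair of standard vertices to the same place: it records a coincidence in the orbit
of that pair.  Its value is

  46473671219695    95783081893188
     68008890048      140167559695

of determinant 1 ([loopE]).  All entries are positive, so all entries of every
positive power are positive; no such power is diagonal, hence none is trivial in
PSL_2 ([loop_class_order]).

The value of the word is a finite computation over Z once denominators are
cleared: 3A, 3A^-1, 8B and 8B^-1 are integral, so the product of the integral
matrices is compared with 3^a 8^b times the matrix above.  This is done with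
binary integers, since the entries before division have about forty digits. *)

Set Implicit Arguments.
Unset Strict Implicit.
Unset Printing Implicit Defensive.

Import Order.TTheory GRing.Theory Num.Theory.

Local Open Scope classical_set_scope.
Local Open Scope ring_scope.
Local Delimit Scope Z_scope with ZZ.

(** * Two by two matrices *)

Lemma mx2M (R : comNzRingType) (a b c d a' b' c' d' : R) :
  mx2 a b c d *m mx2 a' b' c' d' =
  mx2 (a * a' + b * c') (a * b' + b * d') (c * a' + d * c') (c * b' + d * d').
Proof.
apply/matrixP => i j; rewrite !mxE !big_ord_recl big_ord0 addr0 !mxE /=.
by case: (i == 0); case: (j == 0).
Qed.

Lemma map_mx2 (S T : Type) (f : S -> T) (a b c d : S) :
  map_mx f (mx2 a b c d) = mx2 (f a) (f b) (f c) (f d).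
Proof.
by apply/matrixP => i j; rewrite !mxE; case: (i == 0); case: (j == 0).
Qed.

Lemma scale_mx2 (R : comNzRingType) (k a b c d : R) :
  k *: mx2 a b c d = mx2 (k * a) (k * b) (k * c) (k * d).
Proof.
by apply/matrixP => i j; rewrite !mxE; case: (i == 0); case: (j == 0).
Qed.

Lemma mx2_1 (R : comNzRingType) : mx2 1 0 0 1 = 1%:M :> 'M[R]_2.
Proof.
by apply/matrixP => i j; rewrite !mxE; case: i => [[|[]]]; case: j => [[|[]]].
Qed.

Lemma adj_mx2 (R : comNzRingType) (a b c d : R) :
  \adj (mx2 a b c d) = mx2 d (- b) (- c) a.
Proof.
apply/matrixP => i j; rewrite !mxE /cofactor det_mx11 !mxE.
by case: i => [[|[]]]//; case: j => [[|[]]]//= *; rewrite ?expr0 ?expr1 ?expr2; ring.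
Qed.

Lemma detX (R : comNzRingType) m (M : 'M[R]_m.+1) n : \det (M ^+ n) = \det M ^+ n.
Proof.
elim: n => [|n IH]; first by rewrite !expr0 det1.
by rewrite !exprS -IH -det_mulmx.
Qed.

Lemma mxX_gt0 (R : numDomainType) m (M : 'M[R]_m.+1) n :
  (forall i j, 0 < M i j) -> forall i j, 0 < (M ^+ n.+1) i j.
Proof.
move=> M_gt0; elim: n => [|n IH] i j; first by rewrite expr1.
rewrite exprS mxE big_ord_recl ltr_pwDl ?mulr_gt0//.
by apply: sumr_ge0 => k _; rewrite ltW// mulr_gt0.
Qed.

Lemma SL2_mxM (R : comUnitRingType) (g h : SL2 R) :
  SL2_mx (g * h)%g = SL2_mx g *m SL2_mx h.
Proof. by []. Qed.

Lemma SL2_mx1 (R : comUnitRingType) : SL2_mx (1%g : SL2 R) = 1%:M.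
Proof. by []. Qed.

Lemma SL2_mxV (R : comUnitRingType) (g : SL2 R) :
  SL2_mx g^-1%g = \adj (SL2_mx g).
Proof.
have gV : SL2_mx g *m \adj (SL2_mx g) = 1%:M.
  by rewrite mul_mx_adj (eqP (valP g)).
by rewrite -[LHS]mulmx1 -gV mulmxA -SL2_mxM mulVg SL2_mx1 mul1mx.
Qed.

Lemma SL2_mxX (R : comUnitRingType) (g : SL2 R) n :
  SL2_mx (g ^+ n)%g = SL2_mx g ^+ n.
Proof. by elim: n => [|n IH] //; rewrite expgS exprS SL2_mxM IH. Qed.

(** * Fixed vertices of integral matrices *)

Section StandardVertex.
Variables (O : comNzRingType) (K : fieldType) (iota : {rmorphism O -> K}).

Fact standard_lattice_subproof :
  lattice_pred iota [set map_mx iota v | v in [set: 'cV[O]_2]].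
Proof.
apply/asboolP; exists 1%:M; split; first exact: unitmx1.
by apply: eq_imagel => v _; rewrite mul1mx.
Qed.

Definition standard_lattice : lattice iota := Lattice standard_lattice_subproof.

Definition standard_vertex : vertex iota := homothety_class standard_lattice.

(** The integral matrix N maps O^2 into itself, and so does its adjugate, which
is its inverse. *)
Lemma standard_vertex_fixed (g : GL2 K) (N : 'M[int]_2) :
  unit_val g = map_mx intr N -> \det N = 1 ->
  vertex_act (coset_class (scalars K) g) standard_vertex = standard_vertex.
Proof.
move=> gN detN; rewrite vertex_actE; congr homothety_class.
have iotaN (A : 'M[int]_2) (v : 'cV[O]_2) :
    map_mx intr A *m map_mx iota v = map_mx iota (map_mx intr A *m v).
  rewrite map_mxM -map_mx_comp; congr (_ *m _).
  by apply/matrixP => i j; rewrite !mxE /= rmorph_int.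
apply/val_inj; rewrite /= gN; apply/seteqP; split=> [_ [_ [v _ <-] <-]|_ [v _ <-]].
  by rewrite iotaN; exists (map_mx intr N *m v).
exists (map_mx iota (map_mx intr (\adj N) *m v)).
  by exists (map_mx intr (\adj N) *m v).
by rewrite iotaN mulmxA -map_mxM mul_mx_adj detN map_mx1 mul1mx.
Qed.

End StandardVertex.

Section VertexPoint.
Variables (R : realType) (V : choiceType) (adj : V -> V -> Prop).

Fact vertex_point_subproof (v : V) :
  realization_pred adj (edge_point v v (0 : R)).
Proof. by apply/asboolP; exists v, v, 0; split; [left|rewrite lexx ler01|]. Qed.

Definition vertex_point (v : V) : realization R adj :=
  RealizationPoint (vertex_point_subproof v).

Lemma vertex_point_fixed (f : graph_aut adj) (v : V) :
  f v = v -> realization_act f (vertex_point v) = vertex_point v.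
Proof.
move=> fv; apply/val_inj/funext => u /=; rewrite /edge_point.
by rewrite !(can2_eq (aut_invK f) (aut_funK f)) fv.
Qed.

End VertexPoint.

Definition standard_point (R : realType) (p : nat) (p_prime : prime p) :
    bt_tree p_prime R :=
  vertex_point R (tree_adj p (@of_padic_int p p_prime))
    (standard_vertex (@of_padic_int p p_prime)).

Lemma standard_point_fixed (R : realType) (p : nat) (p_prime : prime p)
    (g : SL2 zinv6) (N : 'M[int]_2) :
  SL2_mx g = map_mx intr N -> \det N = 1 ->
  bt_act (PSL2_to_PGL2_padic p_prime (coset_class (pm1 zinv6) g))
    (standard_point R p_prime) = standard_point R p_prime.
Proof.
move=> gN detN; apply: vertex_point_fixed => /=.
rewrite /PSL2_to_PGL2_padic PSL2_to_PGL2E PGL2_mapE.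
apply: standard_vertex_fixed detN.
rewrite /= -[unit_val _]/(SL2_mx g) gN -map_mx_comp.
by apply/matrixP => i j; rewrite !mxE /= rmorph_int.
Qed.

(** * Binary integer matrices *)

(** The entries a, b, c, d of a matrix, as a tuple that the kernel evaluates;
entries of an abstract matrix do not reduce to binary numerals. *)
Definition quad := (Z * Z * Z * Z)%type.

Definition quad_mx (q : quad) : 'M[Z]_2 :=
  let: (a, b, c, d) := q in mx2 a b c d.

Definition quad_mul (q r : quad) : quad :=
  let: (a, b, c, d) := q in let: (a', b', c', d') := r in
  (a * a' + b * c', a * b' + b * d', c * a' + d * c', c * b' + d * d')%ZZ.

Definition quad_scale (k : Z) (q : quad) : quad :=
  let: (a, b, c, d) := q in (k * a, k * b, k * c, k * d)%ZZ.

Definition quad_adj (q : quad) : quad :=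
  let: (a, b, c, d) := q in (d, - b, - c, a)%ZZ.

Lemma quad_mulE q r : quad_mx (quad_mul q r) = quad_mx q *m quad_mx r.
Proof. by case: q r => [[[a b] c] d] [[[a' b'] c'] d']; rewrite /= mx2M. Qed.

Lemma quad_scaleE k q : quad_mx (quad_scale k q) = k *: quad_mx q.
Proof. by case: q => [[[a b] c] d]; rewrite /= scale_mx2. Qed.

Lemma quad_adjE q : quad_mx (quad_adj q) = \adj (quad_mx q).
Proof. by case: q => [[[a b] c] d]; rewrite /= adj_mx2. Qed.

Definition Z_to_zinv6 : Z -> zinv6 := intr \o int_of_Z.
HB.instance Definition _ := GRing.RMorphism.copy Z_to_zinv6
  ((intr : int -> zinv6) \o int_of_Z).

Definition zinv6_quad (q : quad) : 'M[zinv6]_2 := map_mx Z_to_zinv6 (quad_mx q).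

Lemma zinv6_quadM q r :
  zinv6_quad (quad_mul q r) = zinv6_quad q *m zinv6_quad r.
Proof. by rewrite /zinv6_quad quad_mulE map_mxM. Qed.

Lemma zinv6_quadZ k q :
  zinv6_quad (quad_scale k q) = Z_to_zinv6 k *: zinv6_quad q.
Proof. by rewrite /zinv6_quad quad_scaleE map_mxZ. Qed.

Lemma int_of_Z_gt0 (z : Z) : (0 < z)%ZZ -> 0 < int_of_Z z.
Proof.
by case: z => // p _ /=; rewrite ltz_nat; apply/ssrnat.ltP; exact: Pos2Nat.is_pos.
Qed.

(** * Words in the generators *)

Inductive letter := A | A' | B | B'.

Definition letter_elt (l : letter) : SL2 zinv6 :=
  match l with
  | A => SL2_of_mx det_genA
  | A' => (SL2_of_mx det_genA)^-1
  | B => SL2_of_mx det_genB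
  | B' => (SL2_of_mx det_genB)^-1
  end%g.

Definition letter_den (l : letter) : Z :=
  match l with A | A' => 3 | B | B' => 8 end%ZZ.

Definition letter_num (l : letter) : quad :=
  match l with
  | A => (9, 0, 0, 1)
  | A' => (1, 0, 0, 9)
  | B => (82, 2, 9, 1)
  | B' => (1, -2, -9, 82)
  end%ZZ.

Definition word_elt : seq letter -> SL2 zinv6 :=
  foldr (fun l g => (letter_elt l * g)%g) 1%g.

Definition word_den : seq letter -> Z :=
  foldr (fun l k => (letter_den l * k)%ZZ) 1%ZZ.

Definition word_num : seq letter -> quad :=
  foldr (fun l q => quad_mul (letter_num l) q) (1, 0, 0, 1)%ZZ.

Lemma letter_den_unit l : Z_to_zinv6 (letter_den l) \is a GRing.unit.
Proof.
have u3 : Z_to_zinv6 3 \is a GRing.unit by exact: (@zinv6_natr_unit 3 1).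
have u8 : Z_to_zinv6 8 \is a GRing.unit by exact: (@zinv6_natr_unit 8 3).
by case: l.
Qed.

Lemma letterE l :
  Z_to_zinv6 (letter_den l) *: SL2_mx (letter_elt l) = zinv6_quad (letter_num l).
Proof.
have mxA : Z_to_zinv6 3 *: SL2_mx (letter_elt A) = zinv6_quad (letter_num A).
  by rewrite scalerA mulrV ?(letter_den_unit A)// scale1r /zinv6_quad map_mx2.
have mxB : Z_to_zinv6 8 *: SL2_mx (letter_elt B) = zinv6_quad (letter_num B).
  by rewrite scalerA mulrV ?(letter_den_unit B)// scale1r /zinv6_quad map_mx2.
(* In size 2 the adjugate is linear, so the inverse of a generator has the same
   denominator as the generator. *)
have adj2Z (k : zinv6) (M : 'M_2) : \adj (k *: M) = k *: \adj M.
  by rewrite adjZ expr1.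
case: l => //; rewrite [letter_elt _]/= SL2_mxV -adj2Z.
  by rewrite [_ *: _]mxA /zinv6_quad -map_mx_adj -quad_adjE.
by rewrite [_ *: _]mxB /zinv6_quad -map_mx_adj -quad_adjE.
Qed.

Lemma word_den_unit w : Z_to_zinv6 (word_den w) \is a GRing.unit.
Proof.
elim: w => [|l w IH] /=; first by rewrite rmorph1 unitr1.
by rewrite (rmorphM Z_to_zinv6) unitrM letter_den_unit IH.
Qed.

(** Reduces an identity between words over Z[1/6] to an evaluation over Z. *)
Lemma wordE w :
  Z_to_zinv6 (word_den w) *: SL2_mx (word_elt w) = zinv6_quad (word_num w).
Proof.
elim: w => [|l w IH] /=.
  by rewrite rmorph1 scale1r SL2_mx1 /zinv6_quad /= mx2_1 map_mx1.
rewrite (rmorphM Z_to_zinv6) SL2_mxM zinv6_quadM -IH -letterE.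
by rewrite -scalemxAl -scalemxAr scalerA.
Qed.

Lemma Gamma_subgroup : is_subgroup Gamma.
Proof.
split=> [H [[H1 _] _]|x y Gx Gy H HG]; first exact: H1.
by case: (HG) => [[_ HV] _]; apply: HV; [exact: Gx|exact: Gy].
Qed.

Lemma GammaV x : Gamma x -> Gamma x^-1%g.
Proof. by case: Gamma_subgroup => G1 GV Gx; rewrite -div1g; exact: GV. Qed.

Lemma GammaM x y : Gamma x -> Gamma y -> Gamma (x * y)%g.
Proof.
by move=> Gx /GammaV Gy; rewrite -[y]invgK; exact: Gamma_subgroup.2.
Qed.

Lemma GammaX x n : Gamma x -> Gamma (x ^+ n)%g.
Proof.
move=> Gx; elim: n => [|n IH]; first exact: Gamma_subgroup.1.
by rewrite expgS; exact: GammaM.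
Qed.

Lemma word_Gamma w : Gamma (coset_class (pm1 zinv6) (word_elt w)).
Proof.
elim: w => [|l w IH] /=; first exact: Gamma_subgroup.1.
rewrite coset_classM; apply: GammaM => //.
have GA : Gamma (coset_class (pm1 zinv6) (letter_elt A)).
  by move=> H [_]; apply; left.
have GB : Gamma (coset_class (pm1 zinv6) (letter_elt B)).
  by move=> H [_]; apply; right.
by case: l => //=; rewrite coset_classV; exact: GammaV.
Qed.

(** * An integral element of infinite order *)

(** The lines are h^-1 and g: the words h and g send the pair of standard
vertices to the same pair. *)
Definition loop : seq letter :=
  [:: A; A; B; A'; B; A; A; B'; A'; A'; B; A'; A'; B'; B'; A; B; A'; A'; A'; B';
      A'; B; B; B; A; A; B'; A'; B'; A; A; B; A'; A'; B'; A'; A'; B; B; A'; A'].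

Definition loop_num : quad :=
  (46473671219695, 95783081893188, 68008890048, 140167559695)%ZZ.

Definition loop_mx : 'M[int]_2 := map_mx int_of_Z (quad_mx loop_num).

Lemma loopE : SL2_mx (word_elt loop) = map_mx intr loop_mx.
Proof.
have num : word_num loop = quad_scale (word_den loop) loop_num by vm_compute.
apply: (scaler_injl (word_den_unit loop)); rewrite wordE num zinv6_quadZ.
by congr (_ *: _); rewrite /zinv6_quad /loop_mx -map_mx_comp.
Qed.

Lemma loop_mx_gt0 i j : 0 < loop_mx i j.
Proof.
rewrite !mxE; apply: int_of_Z_gt0.
by case: ifP => _; case: ifP.
Qed.

Lemma det_loop_mx : \det loop_mx = 1.
Proof. by rewrite /loop_mx det_map_mx det_mx2 -[RHS](rmorph1 int_of_Z). Qed.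

Lemma loopXE n : SL2_mx (word_elt loop ^+ n)%g = map_mx intr (loop_mx ^+ n).
Proof. by rewrite SL2_mxX loopE rmorphXn. Qed.

Definition loop_class : PSL2 zinv6 := coset_class (pm1 zinv6) (word_elt loop).

Lemma loop_classX n :
  (loop_class ^+ n)%g = coset_class (pm1 zinv6) (word_elt loop ^+ n)%g.
Proof. by elim: n => [|n IH] //; rewrite !expgS coset_classM -IH. Qed.

(** The upper right entry of a positive power is positive, whereas that of 1 and
of -1 is zero. *)
Lemma loop_class_order n : (loop_class ^+ n.+1)%g != 1%g.
Proof.
apply/eqP; rewrite loop_classX -coset_class1 => /esym/coset_eqP.
rewrite invg1 mul1g unfold_in /= /pm1_pred loopXE => /orP[]/eqP/matrixP/(_ 0 1).
(* The comparison with zero takes place in the rationals, which are ordered. *)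
all: rewrite !mxE /= ?oppr0 => /(congr1 (val : zinv6 -> rat))/eqP.
all: rewrite rmorph_int rmorph0 intr_eq0; apply/negP.
all: by rewrite gt_eqF// mxX_gt0// => i j; exact: loop_mx_gt0.
Qed.

Lemma loop_class_inj : injective (fun n => loop_class ^+ n)%g.
Proof.
suff lt_neq m n : (m < n)%N -> (loop_class ^+ m)%g <> (loop_class ^+ n)%g.
  by move=> m n mn; case: (ltngtP m n) => // /lt_neq; rewrite mn.
move=> /subnKC <-; rewrite addSnnS expgnDr; apply/eqP.
by rewrite -[X in X != _]mulg1 (inj_eq (mulgI _)) eq_sym loop_class_order.
Qed.

Theorem theorem1 (R : realType) : ~ proper_action Gamma (@diagonal_act R).
Proof.
pose x : T3 R * T4 R := (standard_point R _, standard_point R _).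
move=> /(_ [set x] (@compact_set1 _ x)); set S := [set g | _] => finS.
apply: infinite_nat.
have -> : [set: nat] = (fun n => loop_class ^+ n)%g @^-1` S.
  apply/esym/seteqP; split=> // n _; split.
    by apply: GammaX; exact: word_Gamma.
  have detXn : \det (loop_mx ^+ n) = 1 by rewrite detX det_loop_mx expr1n.
  exists x; split=> //; exists x => //.
  by rewrite /diagonal_act loop_classX !(standard_point_fixed _ _ (loopXE n) detXn).
by apply: finite_preimage finS => m n _ _; exact: loop_class_inj.
Qed.
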